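(* Let $0<p<\infty$ and $0<q<r\le\infty$. Then the natural embedding (inclusion map) $\ell_{p,q}\hookrightarrow\ell_{p,r}$, $u\mapsto u$, between Lorentz sequence spaces is strictly singular.
   Context: Sequences are real and indexed by $\mathbb{N}=\{1,2,\dots\}$. For a sequence $u$ its non-increasing rearrangement is $u^*(j)=\inf\{\lambda\ge 0:\ \#\{i:|u(i)|>\lambda\}\le j-1\}$ for $j\in\mathbb{N}$ (with $\inf\emptyset=\infty$). For $0<p<\infty$ and $0<q\le\infty$ put $$\|u\|_{p,q}=\Big(\sum_{j=1}^\infty j^{q/p-1}(u^*(j))^q\Big)^{1/q}\ \text{ if } q<\infty,\qquad \|u\|_{p,\infty}=\sup_{j\ge1} j^{1/p}u^*(j).$$ The Lorentz sequence space $\ell_{p,q}$ consists of all real sequences $u$ with $\|u\|_{p,q}<\infty$; it is a quasi-Banach space under $\|\cdot\|_{p,q}$, and for $q<r$ one has $\ell_{p,q}\subset\ell_{p,r}$ with bounded inclusion. A bounded linear operator $T:X\to Y$ between quasi-Banach spaces is called strictly singular if $\inf\{\|Tx\|_Y:\ x\in Z,\ \|x\|_X=1\}=0$ for each infinite-dimensional linear subspace $Z\subset X$. *)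

(* Defs.v *)
From HB Require Import structures.
From mathcomp Require Import all_boot all_order all_algebra.
From mathcomp Require Import all_classical all_reals all_analysis.
Import Order.TTheory GRing.Theory Num.Theory.
Import numFieldNormedType.Exports.

Set Implicit Arguments.
Unset Strict Implicit.
Unset Printing Implicit Defensive.

Local Open Scope classical_set_scope.
Local Open Scope card_scope.
Local Open Scope ring_scope.

(* Sequences indexed by {1, 2, ...} are encoded with a shift: for
   u : nat -> R, u i is the term of index i + 1.  Likewise rearr u j is
   u^*(j + 1), so that "at most (j + 1) - 1 indices" becomes "#<= `I_j" and the
   weights below are powers of j.+1. *)

Section Lorentz.
Variable R : realType.

Definition rearr (u : nat -> R) (j : nat) : \bar R :=
  ereal_inf [set l%:E | l in [set l : R |
    0 <= l /\ [set i | l < `|u i|] #<= `I_j]].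

(* Only meant for 0 < p and 0 < q; the value at q = -oo is junk. *)
Definition lorentz_norm (p : R) (q : \bar R) (u : nat -> R) : \bar R :=
  match q with
  | q'%:E =>
      (poweR (\sum_(0 <= j <oo)
         ((j.+1%:R `^ (q' / p - 1))%:E * poweR (rearr u j) q')) q'^-1)%E
  | +oo%E => ereal_sup (range (fun j => (j.+1%:R `^ p^-1)%:E * rearr u j)%E)
  | -oo%E => 0%E
  end.

Definition lorentz (p : R) (q : \bar R) : set (nat -> R) :=
  [set u | (lorentz_norm p q u < +oo)%E].

End Lorentz.

Section StrictlySingular.
Variable R : realType.

Definition finite_dimensional (V : lmodType R) (Z : set V) : Prop :=
  exists (n : nat) (e : 'I_n -> V), (forall i, Z (e i)) /\
    forall z, Z z -> exists c : 'I_n -> R, z = \sum_(i < n) c i *: e i.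

(* A (quasi-)normed space is represented as a linear subspace X of an ambient
   vector space V, with a functional NX on V, finite on X, giving the
   quasi-norm of X; an operator X -> Y is the restriction to X of a map between
   the ambient spaces. *)
Definition bounded_linear (V W : lmodType R)
    (X : set V) (NX : V -> \bar R) (Y : set W) (NY : W -> \bar R)
    (T : V -> W) : Prop :=
  [/\ forall x, X x -> Y (T x),
      forall (a : R) x y, X x -> X y -> T (a *: x + y) = a *: T x + T y &
      exists C : R, forall x, X x -> (NY (T x) <= C%:E * NX x)%E].

Definition strictly_singular (V W : lmodType R)
    (X : set V) (NX : V -> \bar R) (Y : set W) (NY : W -> \bar R)
    (T : V -> W) : Prop :=
  bounded_linear X NX Y NY T /\
  forall Z : set V, Z `<=` X -> submod_closed [in Z] -> ~ finite_dimensional Z ->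
    ereal_inf [set NY (T x) | x in Z `&` [set x | NX x = 1%E]] = 0%E.

End StrictlySingular.

(* Main.v *)
Require Import Defs.
From mathcomp Require Import all_boot all_order all_algebra.
From mathcomp Require Import all_classical all_reals all_analysis.
From mathcomp Require Import lra ring zify.
Import Order.TTheory GRing.Theory Num.Theory.
Import numFieldNormedType.Exports.

Local Open Scope classical_set_scope.
Local Open Scope ring_scope.

Set Implicit Arguments.
Unset Strict Implicit.
Unset Printing Implicit Defensive.

(** Write [u^*] for the rearrangement and [phi_u j = j^(1/p) u^*(j)] for the
    profile of [u], whose supremum is the weak quasi-norm, exponent [+oo].

    Splitting each term of the [r]-sum as [phi_u(j)^(r-q)] times the term of
    the [q]-sum gives
      [||u||_(p,r) <= (sup phi_u)^(1-q/r) ||u||_(p,q)^(q/r)]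
    ([lorentz_norm_interp]), and comparing [u^*(b)] with the terms of indices
    in [[b/2, b]] bounds [sup phi_u] by a multiple of [||u||_(p,q)]
    ([block_ge]).  Hence the inclusion is bounded, and strict singularity only
    asks for vectors of the subspace [Z] with [sup phi_u] small compared with
    [||u||_(p,q)], whatever [r] is.

    Such vectors come from two gliding humps.

    - Since [Z] is infinite-dimensional, it contains nonzero vectors vanishing
      on any given initial segment; adding [n] of them, each starting where the
      previous ones have become negligible, gives a vector bounded by 2 that is
      at least 1/2 at [n] indices ([flat_vector]).  Its profile reaches about
      [n^(1/p) / 2], so after normalising the profile to have supremum 1 the
      sup norm is as small as desired ([spread_vector]).

    - On [l_(p,q)] with [q] finite every profile tends to 0.  Add to [y] a
      vector [x] of [Z] with profile at most 1 and tiny sup norm.  At the small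
      indices the profile of [y] is hardly modified, as [x^*(0)] is tiny; at
      the large ones, [(y + x)^*(2j) <= y^*(j) + x^*(j)] where the first term
      is negligible, so the profile of [y + x] stays below a constant, while
      the hump of [x] survives.  Iterating ([many_humps]) gives vectors whose
      profile is bounded by a fixed constant and exceeds another fixed constant
      at [N] well-separated indices; each of these contributes a fixed amount
      to the [q]-sum ([humps_sum]), so [||y||_(p,q)] is at least of order
      [N^(1/q)].  Rearrangements are subadditive in the above sense, so the
      supports of the summands never have to be disjoint. *)

(** * Preliminaries *)

Lemma powR_le_root (R : realType) (q x y : R) : 0 < q -> 0 <= x -> 0 <= y ->
  x `^ q <= y -> x <= y `^ q^-1.
Proof.
move=> q0 x0 y0 /(ge0_ler_powR (r := q^-1)).
rewrite !nnegrE powR_ge0 y0 -powRrM divff ?gt_eqF// powRr1//.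
by apply; rewrite // invr_ge0 ltW.
Qed.

Lemma powR_lel (R : realType) (q x y : R) : 0 < q -> 0 <= x -> 0 <= y ->
  x `^ q <= y `^ q -> x <= y.
Proof.
move=> q0 x0 y0 /(powR_le_root q0 x0 (powR_ge0 _ _)).
by rewrite -powRrM divff ?gt_eqF// powRr1.
Qed.

(** Duplicate-free lists are the handy form of the cardinality condition in the
    rearrangement: a list splits by filtering, and explicit lists are the way
    in which lower bounds are obtained. *)
Lemma card_le_IIP (A : set nat) n :
  (A #<= `I_n)%card <->
  (forall s : seq nat, uniq s -> (forall i, i \in s -> A i) -> (size s <= n)%N).
Proof.
split.
  move=> An s us sA.
  have fA : finite_set A by apply: card_le_finite An (finite_II n).
  apply: leq_trans (geq_card_fset_set An).
  apply: uniq_leq_size => // i /sA Ai.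
  by rewrite in_fset_set// inE.
move=> H; have [/finite_setP[m Am]|iA] := pselect (finite_set A).
  rewrite (card_le_eql Am) card_le_II -(card_fset_set Am).
  apply: H => [|i]; first exact: finmap.fset_uniq.
  by rewrite in_fset_set ?inE//; apply/finite_setP; exists m.
have [B BA] := infinite_set_fset n.+1 iA.
rewrite ltnNge => /negP[]; apply: H => [|i iB]; last exact: BA.
exact: finmap.fset_uniq.
Qed.

(** * The rearrangement of a bounded sequence *)

Section Star.
Variable R : realType.
Implicit Types (u v : nat -> R) (i j : nat).

Definition bdd u := exists B, forall i, `|u i| <= B.

(** The real-valued rearrangement [u^*].  It agrees with [rearr] exactly when
    [u] is bounded (see [rearrE]); for unbounded [u], [rearr u j] is [+oo] and
    [fine] returns 0. *)
Definition star u j : R := fine (rearr u j).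

Lemma rearr_ge0 u j : (0 <= rearr u j)%E.
Proof. by apply: le_ereal_inf_tmp => _ [l [l0 _] <-]; rewrite lee_fin. Qed.

Lemma star_ge0 u j : 0 <= star u j.
Proof. exact/fine_ge0/rearr_ge0. Qed.

Lemma rearr_leP u j l : 0 <= l ->
  (forall s : seq nat, uniq s -> (forall i, i \in s -> l < `|u i|) ->
    (size s <= j)%N) -> (rearr u j <= l%:E)%E.
Proof.
move=> l0 H; apply: ereal_inf_lbound; exists l => //; split => //.
exact/card_le_IIP.
Qed.

(** Strictness provides an admissible level strictly below [l], so that even the
    indices with [`|u i| = l] are counted. *)
Lemma rearr_ltP u j l (s : seq nat) : (rearr u j < l%:E)%E ->
  uniq s -> (forall i, i \in s -> l <= `|u i|) -> (size s <= j)%N.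
Proof.
move=> /ereal_inf_lt[_ [m [m0 /card_le_IIP mj] <-]]; rewrite lte_fin => ml us sl.
by apply: mj => // i /sl; exact: lt_le_trans.
Qed.

Lemma rearrE u j : bdd u -> rearr u j = (star u j)%:E.
Proof.
move=> [B uB]; rewrite /star fineK// ge0_fin_numE ?rearr_ge0//.
apply: (@le_lt_trans _ _ B%:E); last exact: ltry.
apply: rearr_leP; first by apply: le_trans (uB 0%N).
case=> // i s _ /(_ i); rewrite mem_head => /(_ erefl).
by rewrite ltNge uB.
Qed.

Lemma rearr0_bdd u : (rearr u 0 < +oo)%E -> bdd u.
Proof.
move=> u0; exists (fine (rearr u 0) + 1) => i; rewrite leNgt; apply/negP => h.
have : (rearr u 0 < (fine (rearr u 0) + 1)%:E)%E.
  by rewrite EFinD fineK ?ge0_fin_numE ?rearr_ge0// lteDl// ge0_fin_numE ?rearr_ge0.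
move/rearr_ltP => /(_ [:: i] erefl) /=; rewrite ltnn => H.
suff: false by []; apply: H => j; rewrite inE => /eqP ->; exact: ltW.
Qed.

Lemma star_le u j l : 0 <= l ->
  (forall s : seq nat, uniq s -> (forall i, i \in s -> l < `|u i|) ->
    (size s <= j)%N) -> star u j <= l.
Proof.
move=> l0 /(rearr_leP l0) h; rewrite -lee_fin (le_trans _ h)//.
by rewrite /star fineK// ge0_fin_numE ?rearr_ge0//; apply: le_lt_trans h (ltry _).
Qed.

Lemma size_star u j l (s : seq nat) : bdd u -> star u j < l ->
  uniq s -> (forall i, i \in s -> l <= `|u i|) -> (size s <= j)%N.
Proof. by move=> bu; rewrite -lte_fin -rearrE//; exact: rearr_ltP. Qed.

Lemma le_star u j l (s : seq nat) : bdd u -> uniq s -> (j < size s)%N ->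
  (forall i, i \in s -> l <= `|u i|) -> l <= star u j.
Proof.
move=> bu us js sl; rewrite leNgt; apply/negP => h.
by have := size_star bu h us sl; rewrite leqNgt js.
Qed.

Lemma star_noninc u i j : bdd u -> (i <= j)%N -> star u j <= star u i.
Proof.
move=> bu ij; apply/ler_addgt0Pl => e e0.
apply: star_le => [|s us sl]; first by rewrite addr_ge0// ?star_ge0// ltW.
apply: leq_trans ij; apply: (@size_star u i (e + star u i)) => //.
  by rewrite ltrDr.
by move=> k /sl /ltW.
Qed.

Lemma normr_le_star0 u i : bdd u -> `|u i| <= star u 0.
Proof.
by move=> bu; apply: (@le_star _ _ _ [:: i]) => // j; rewrite inE => /eqP ->.
Qed.

Lemma star0_le u l : 0 <= l -> (forall i, `|u i| <= l) -> star u 0 <= l.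
Proof.
move=> l0 ul; apply: star_le => //; case=> // i s _ /(_ i).
by rewrite mem_head => /(_ erefl); rewrite ltNge ul.
Qed.

Lemma bddD u v : bdd u -> bdd v -> bdd (u + v).
Proof.
move=> [B uB] [C vC]; exists (B + C) => i.
by apply: le_trans (ler_normD _ _) _; exact: lerD.
Qed.

Lemma bddZ a u : bdd u -> bdd (a *: u).
Proof.
move=> [B uB]; exists (`|a| * B) => i.
by rewrite normrM; apply: ler_wpM2l.
Qed.

(** An index where [`|u + v|] exceeds [l + m] is one where [`|u|] is at least
    [l] or [`|v|] is at least [m], and these number at most [i] and [j] when
    [l > u^*(i)] and [m > v^*(j)]. *)
Lemma starD u v i j : bdd u -> bdd v ->
  star (u + v) (i + j) <= star u i + star v j.
Proof.
move=> bu bv; apply/ler_addgt0Pl => e e0.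
pose l := star u i + e / 2; pose m := star v j + e / 2.
have e20 : 0 < e / 2 by rewrite divr_gt0.
have -> : e + (star u i + star v j) = l + m by rewrite /l /m; lra.
have l0 : 0 <= l by rewrite addr_ge0 ?star_ge0 ?ltW.
have m0 : 0 <= m by rewrite addr_ge0 ?star_ge0 ?ltW.
apply: star_le => [|s us sl]; first exact: addr_ge0.
rewrite -(count_predC (fun k => l <= `|u k|) s) leq_add//.
  rewrite -size_filter; apply: (@size_star u i l); rewrite ?filter_uniq//.
    by rewrite ltrDl.
  by move=> k; rewrite mem_filter => /andP[].
rewrite -size_filter; apply: (@size_star v j m); rewrite ?filter_uniq//.
  by rewrite ltrDl.
move=> k; rewrite mem_filter => /andP[/= uk /sl]; rewrite -ltNge in uk.
have := ler_normD (u k) (v k); rewrite -[u k + v k]/((u + v) k).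
by move=> *; lra.
Qed.

Lemma starZ_le a u j : bdd u -> star (a *: u) j <= `|a| * star u j.
Proof.
move=> bu; apply/ler_addgt0Pl => e e0.
apply: star_le => [|s us sl].
  by rewrite addr_ge0 ?mulr_ge0 ?star_ge0 ?normr_ge0 ?(ltW e0).
have [a0|a0] := eqVneq a 0.
  case: s us sl => // i s _ /(_ i); rewrite mem_head => /(_ erefl).
  rewrite a0 normr0 mul0r addr0.
  have -> : (0 *: u) i = 0 by rewrite scale0r.
  by rewrite normr0 => /(lt_trans e0); rewrite ltxx.
have a1 : 0 < `|a| by rewrite normr_gt0.
apply: (@size_star u j (star u j + e / `|a|)) => //.
  by rewrite ltrDl divr_gt0.
move=> i /sl/ltW; rewrite [(a *: u) i]/(a * u i) normrM => h.
by rewrite -(ler_pM2l a1) mulrDr mulrCA divff ?gt_eqF// mulr1 addrC.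
Qed.

Lemma starZ a u j : bdd u -> star (a *: u) j = `|a| * star u j.
Proof.
move=> bu; apply/eqP; rewrite eq_le starZ_le//=.
have [->|a0] := eqVneq a 0; first by rewrite normr0 mul0r star_ge0.
have := starZ_le a^-1 j (bddZ a bu); rewrite scalerA mulVf// scale1r.
by rewrite normfV -(ler_pM2l (x := `|a|)) ?normr_gt0// mulrA divff ?mul1r ?normr_eq0.
Qed.

Lemma star_small u j l : bdd u -> star u j < l ->
  exists M, forall i, (M <= i)%N -> `|u i| <= l.
Proof.
move=> bu ul.
have fA : finite_set [set i | l <= `|u i|].
  apply: (card_le_finite _ (finite_II j)); apply/card_le_IIP => s us sl.
  exact: (size_star bu ul).
exists (\max_(i <- finmap.enum_fset (fset_set [set i | l <= `|u i|])) i).+1 => i.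
rewrite ltnNge => h; rewrite leNgt; apply: contra h => h.
by rewrite leq_bigmax_seq// in_fset_set// inE/= ltW.
Qed.

End Star.

(** * Profiles and Lorentz quasi-norms *)

Section Profile.
Variables (R : realType) (p : R).
Hypothesis p_gt0 : 0 < p.
Implicit Types (u v : nat -> R) (q : R) (j : nat).

(** The supremum over [j] is the weak quasi-norm [||u||_(p,oo)]. *)
Definition profile u j : R := j.+1%:R `^ p^-1 * star u j.

Definition lterm q u j : R := j.+1%:R `^ (q / p - 1) * star u j `^ q.

Definition lsum q u : \bar R := (\sum_(0 <= j <oo) (lterm q u j)%:E)%E.

(** The factor [2 `^ (q / p)] pays for replacing [j] by [b / 2] in the weights
    of a block [[b/2, b]], and the factor 2 for the block having only [b / 2]
    elements. *)
Definition blockc q : R := (2 `^ (q / p))^-1 / 2.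

Lemma blockc_gt0 q : 0 < blockc q.
Proof. by rewrite divr_gt0// invr_gt0 powR_gt0. Qed.

Lemma profile_ge0 u j : 0 <= profile u j.
Proof. by rewrite mulr_ge0 ?powR_ge0 ?star_ge0. Qed.

Lemma lterm_ge0 q u j : 0 <= lterm q u j.
Proof. by rewrite mulr_ge0 ?powR_ge0. Qed.

Lemma profileZ a u j : bdd u -> profile (a *: u) j = `|a| * profile u j.
Proof. by move=> bu; rewrite /profile starZ// mulrCA. Qed.

(** For [j] between [b/2] and [b] the rearrangement is at least [u^*(b)], and
    the weight [j^(q/p-1) = j^(q/p) / j] is at least [(b/2)^(q/p) / b] whatever
    the sign of [q/p-1]. *)
Lemma block_ge q u a b : 0 < q -> bdd u -> (a.*2 <= b.+1)%N ->
  blockc q * profile u b `^ q <= \sum_(a <= j < b.+1) lterm q u j.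
Proof.
move=> q0 bu ab.
pose h := b.+1./2.
have := odd_double_half b.+1; rewrite -/h => hE.
have ah : (a <= h)%N by lia.
have hb : (h <= b.+1)%N by lia.
have b0 : 0 < b.+1%:R :> R by rewrite ltr0n.
rewrite (big_cat_nat ah hb)/=.
apply: (@le_trans _ _ (\sum_(h <= j < b.+1) lterm q u j)); last first.
  by rewrite lerDr sumr_ge0// => i _; exact: lterm_ge0.
(* A lower bound for each term of the block. *)
pose c := (b.+1%:R / 2) `^ (q / p) / b.+1%:R * star u b `^ q.
apply: (@le_trans _ _ (\sum_(h <= j < b.+1) c)).
  rewrite sumr_const_nat -mulr_natr /c /blockc /profile.
  rewrite powRM ?powR_ge0 ?star_ge0// -powRrM (mulrC p^-1).
  rewrite [in leRHS]powRM ?invr_ge0 ?(ltW b0)//.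
  rewrite -[X in _ <= _ * X `^ _ / _ * _ * _]powR_inv1// powRAC powR_inv1 ?powR_ge0//.
  set X := b.+1%:R `^ _; set Y := (2 `^ _)^-1; set T := star u b `^ q.
  have Hn : 2^-1 <= (b.+1 - h)%:R / b.+1%:R :> R.
    by rewrite ler_pdivlMr// ler_pdivrMl// -natrM ler_nat; lia.
  have XYT : 0 <= X * Y * T by rewrite !mulr_ge0 ?invr_ge0 ?powR_ge0.
  have -> : Y / 2 * (X * T) = X * Y * T * 2^-1 by ring.
  have -> : X * Y / b.+1%:R * T * (b.+1 - h)%:R =
            X * Y * T * ((b.+1 - h)%:R / b.+1%:R) by ring.
  exact: ler_wpM2l.
rewrite big_nat [leRHS]big_nat; apply: ler_sum => j /andP[hj jb].
have j0 : 0 < j.+1%:R :> R by rewrite ltr0n.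
rewrite /c /lterm; apply: ler_pM; rewrite ?powR_ge0 ?mulr_ge0 ?invr_ge0 ?powR_ge0//.
  rewrite powRB; last by rewrite (gt_eqF j0) implybT.
  rewrite powRr1 ?(ltW j0)//; apply: ler_pM; rewrite ?invr_ge0 ?powR_ge0//.
    apply: ge0_ler_powR; rewrite ?nnegrE ?divr_ge0 ?(ltW q0) ?(ltW p_gt0)//.
    rewrite ler_pdivrMr// -natrM ler_nat muln2.
    lia.
  by rewrite lef_pV2 ?posrE// ler_nat.
apply: ge0_ler_powR; rewrite ?nnegrE ?star_ge0 ?(ltW q0)//.
by apply: star_noninc.
Qed.

Lemma lsum_ge0 q u : (0 <= lsum q u)%E.
Proof. by apply: nneseries_ge0 => j _ _; rewrite lee_fin lterm_ge0. Qed.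

Lemma sum_le_tail q u h a b : (h <= a)%N ->
  ((\sum_(a <= j < b) lterm q u j)%:E <= \sum_(h <= j <oo) (lterm q u j)%:E)%E.
Proof.
move=> ha; have [ab|/ltnW ba] := leqP a b; last first.
  by rewrite big_geq// nneseries_ge0// => j _ _; rewrite lee_fin lterm_ge0.
apply: (@le_trans _ _ (\sum_(h <= j < b) (lterm q u j)%:E)%E).
  rewrite sumEFin lee_fin [leRHS](big_cat_nat ha ab)/= lerDr.
  by rewrite sumr_ge0// => i _; exact: lterm_ge0.
by apply: nneseries_lim_ge => j _ _; rewrite lee_fin lterm_ge0.
Qed.

Lemma sum_le_lsum q u a b :
  ((\sum_(a <= j < b) lterm q u j)%:E <= lsum q u)%E.
Proof. exact: sum_le_tail. Qed.

Lemma lorentz_normE q u : bdd u ->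
  lorentz_norm p q%:E u = poweR (lsum q u) q^-1.
Proof.
move=> bu; rewrite /lorentz_norm /lsum; congr poweR.
by apply: eq_eseriesr => j _; rewrite rearrE// poweR_EFin -EFinM.
Qed.

Lemma lorentz_normyE u : bdd u ->
  lorentz_norm p +oo u = ereal_sup (range (fun j => (profile u j)%:E)).
Proof.
move=> bu; rewrite /lorentz_norm; congr ereal_sup; congr (image setT _).
by apply/funext => j; rewrite rearrE// -EFinM.
Qed.

(** An unbounded sequence has an infinite rearrangement, and already the first
    term of the sum is then infinite. *)
Lemma lorentz_bdd q u : 0 < q -> lorentz p q%:E u -> bdd u.
Proof.
move=> q0; rewrite /lorentz/= => uq; apply: rearr0_bdd.
rewrite ltNge leye_eq; apply/negP => /eqP u0; move: uq; rewrite ltNge => /negP[].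
rewrite leye_eq; apply/eqP.
set S := (X in poweR X _); suff -> : S = +oo%E by rewrite poweRyr// invr_eq0 gt_eqF.
apply/eqP; rewrite -leye_eq.
have := @nneseries_lim_ge R (fun j => (j.+1%:R `^ (q / p - 1))%:E * poweR (rearr u j) q)%E xpredT 0%N 1%N.
rewrite big_nat1 u0 poweRyr ?gt_eqF// gt0_muley; last by rewrite lte_fin powR_gt0.
by apply=> j _ _; rewrite mule_ge0// ?poweR_ge0// lee_fin powR_ge0.
Qed.

Lemma lorentz_lsum q u : 0 < q -> lorentz p q%:E u -> lsum q u \is a fin_num.
Proof.
move=> q0 uq; have bu := lorentz_bdd q0 uq.
move: uq; rewrite -[lorentz _ _ _]/(is_true (lorentz_norm _ _ _ < _)%E) lorentz_normE// => uq.
rewrite ge0_fin_numE ?lsum_ge0// ltNge leye_eq; apply/negP => /eqP E.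
by move: uq; rewrite E poweRyr ?ltxx// invr_eq0 gt_eqF.
Qed.

Lemma profile_le q u j : 0 < q -> lorentz p q%:E u ->
  blockc q * profile u j `^ q <= fine (lsum q u).
Proof.
move=> q0 uq; have bu := lorentz_bdd q0 uq.
apply: le_trans (@block_ge q u 0%N j q0 bu isT) _.
by rewrite -lee_fin fineK ?lorentz_lsum// sum_le_lsum.
Qed.

(** By [block_ge], [phi_u(b)^q] is dominated by the tail from [b/2] on of a
    convergent series. *)
Lemma profile_cvg0 q u e : 0 < q -> lorentz p q%:E u -> 0 < e ->
  exists M, forall j, (M <= j)%N -> profile u j <= e.
Proof.
move=> q0 uq e0; have bu := lorentz_bdd q0 uq.
have d0 : 0 < blockc q * e `^ q by rewrite mulr_gt0 ?blockc_gt0 ?powR_gt0.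
have := @nneseries_tail_cvg R (fun j => (lterm q u j)%:E) xpredT.
rewrite -ge0_fin_numE ?lsum_ge0// lorentz_lsum// => /(_ isT).
have H0 k : xpredT k -> (0 <= (lterm q u k)%:E)%E by rewrite lee_fin lterm_ge0.
have d0' : ((0 : \bar R) < (blockc q * e `^ q)%:E)%E by rewrite lte_fin.
move=> /(_ H0) /(_ _ (open_ereal_lt' d0')) [h _ hP]; exists (h.*2) => j hj.
have aj : (j.+1./2.*2 <= j.+1)%N by have := odd_double_half j.+1; lia.
have ha : (h <= j.+1./2)%N by have := odd_double_half j.+1; lia.
have := block_ge q0 bu aj; rewrite -lee_fin => /le_trans.
move=> /(_ _ (sum_le_tail q u j.+1 ha)) /le_lt_trans /(_ (hP h (leqnn h))).
rewrite lte_fin ltr_pM2l ?blockc_gt0// => /ltW.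
by apply: powR_lel; rewrite ?profile_ge0 ?(ltW e0).
Qed.

(** The real value of the quasi-norm on [lorentz p q], see
    [lorentz_norm_fin]. *)
Definition lnorm q u : R := fine (lsum q u) `^ q^-1.

Lemma lorentz_norm_fin q u : 0 < q -> lorentz p q%:E u ->
  lorentz_norm p q%:E u = (lnorm q u)%:E.
Proof.
move=> q0 uq; rewrite lorentz_normE; last exact: lorentz_bdd uq.
by rewrite -[in LHS](fineK (lorentz_lsum q0 uq)) poweR_EFin.
Qed.

Lemma lnormK q u : 0 < q -> lnorm q u `^ q = fine (lsum q u).
Proof.
by move=> q0; rewrite -powRrM mulVf ?gt_eqF// powRr1// fine_ge0// lsum_ge0.
Qed.

Lemma lsumZ q a u : 0 < q -> bdd u ->
  lsum q (a *: u) = ((`|a| `^ q)%:E * lsum q u)%E.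
Proof.
move=> q0 bu; rewrite /lsum -nneseriesZl; last first.
  by move=> j _; rewrite lee_fin lterm_ge0.
apply: eq_eseriesr => j _; rewrite -EFinM; congr EFin.
by rewrite /lterm starZ// powRM ?star_ge0// mulrCA.
Qed.

Lemma lnormZ q a u : 0 < q -> lorentz p q%:E u ->
  lnorm q (a *: u) = `|a| * lnorm q u.
Proof.
move=> q0 uq; rewrite /lnorm lsumZ//; last exact: lorentz_bdd uq.
rewrite fineM ?lorentz_lsum//= powRM ?powR_ge0 ?fine_ge0 ?lsum_ge0//.
by rewrite -powRrM divff ?gt_eqF// powRr1.
Qed.

Lemma profile_le_lnorm q u j : 0 < q -> lorentz p q%:E u ->
  profile u j <= (blockc q)^-1 `^ q^-1 * lnorm q u.
Proof.
move=> q0 uq; rewrite /lnorm -powRM ?invr_ge0 ?(ltW (blockc_gt0 q)) ?fine_ge0 ?lsum_ge0//.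
apply: powR_le_root; rewrite ?profile_ge0//.
  by rewrite mulr_ge0 ?invr_ge0 ?(ltW (blockc_gt0 q)) ?fine_ge0 ?lsum_ge0.
by rewrite ler_pdivlMl ?blockc_gt0// profile_le.
Qed.

Lemma lterm_interp q r u j : 0 < q -> q < r ->
  lterm r u j = profile u j `^ (r - q) * lterm q u j.
Proof.
move=> q0 qr; have j0 : 0 < j.+1%:R :> R by rewrite ltr0n.
rewrite /lterm /profile powRM ?powR_ge0 ?star_ge0// mulrACA -powRrM.
rewrite -!powRD; first by congr (_ `^ _ * _ `^ _); ring.
  by rewrite subrK gt_eqF ?(lt_trans q0).
by rewrite (gt_eqF j0) implybT.
Qed.

Lemma lsum_interp q r u B : 0 < q -> q < r -> (forall j, profile u j <= B) ->
  (lsum r u <= (B `^ (r - q))%:E * lsum q u)%E.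
Proof.
move=> q0 qr uB; rewrite /lsum -nneseriesZl; last first.
  by move=> j _; rewrite lee_fin lterm_ge0.
apply: lee_nneseries => j _; first by rewrite lee_fin lterm_ge0.
rewrite -EFinM lee_fin (lterm_interp _ _ q0 qr) ler_wpM2r ?lterm_ge0//.
apply: ge0_ler_powR; rewrite ?nnegrE ?subr_ge0 ?(ltW qr) ?profile_ge0//.
exact: le_trans (profile_ge0 _ _) (uB 0%N).
Qed.

Lemma lorentz_norm_interp q r u B : 0 < q -> q < r -> lorentz p q%:E u ->
  (forall j, profile u j <= B) ->
  (lorentz_norm p r%:E u <= (B `^ (1 - q / r) * lnorm q u `^ (q / r))%:E)%E.
Proof.
move=> q0 qr uq uB; have r0 := lt_trans q0 qr.
have B0 : 0 <= B by exact: le_trans (profile_ge0 _ _) (uB 0%N).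
have := lsum_interp q0 qr uB; rewrite -(fineK (lorentz_lsum q0 uq)) -EFinM => h.
have f : lsum r u \is a fin_num.
  by rewrite ge0_fin_numE ?lsum_ge0//; apply: le_lt_trans h (ltry _).
rewrite lorentz_normE; last exact: lorentz_bdd uq.
move: h; rewrite -(fineK f) lee_fin poweR_EFin lee_fin.
move=> /(ge0_ler_powR (r := r^-1)); rewrite !nnegrE invr_ge0 (ltW r0).
rewrite !mulr_ge0 ?powR_ge0 ?fine_ge0 ?lsum_ge0// => /(_ isT isT isT).
move=> /le_trans; apply.
rewrite powRM ?powR_ge0 ?fine_ge0 ?lsum_ge0// -powRrM mulrBl divff ?gt_eqF//.
by rewrite powRrM lnormK.
Qed.

(** On the unit sphere of [l_(p,q)], a uniformly small profile forces a small
    quasi-norm in [l_(p,r)]; the choice of [r] is forgotten from here on. *)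
Lemma lorentz_norm_small q (r : \bar R) e : 0 < q -> (q%:E < r)%E -> 0 < e ->
  exists2 d, 0 < d & forall u, lorentz p q%:E u -> lnorm q u = 1 ->
    (forall j, profile u j <= d) -> (lorentz_norm p r u <= e%:E)%E.
Proof.
move=> q0; case: r => [r| |//]; last first.
  move=> _ e0; exists e => // u uq _ ud; rewrite lorentz_normyE; last first.
    exact: lorentz_bdd uq.
  by apply: ge_ereal_sup => _ [j _ <-]; rewrite lee_fin.
rewrite lte_fin => qr e0; have r0 := lt_trans q0 qr.
have t0 : 0 < 1 - q / r by rewrite subr_gt0 ltr_pdivrMr ?mul1r.
exists (e `^ (1 - q / r)^-1); first exact: powR_gt0.
move=> u uq u1 /(lorentz_norm_interp q0 qr uq); rewrite u1 powR1 mulr1.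
by rewrite -powRrM mulVf ?gt_eqF// powRr1 ?(ltW e0).
Qed.

Lemma lorentz_norm_le q (r : \bar R) : 0 < q -> (q%:E < r)%E ->
  exists C, forall u, lorentz p q%:E u ->
    (lorentz_norm p r u <= C%:E * lorentz_norm p q%:E u)%E.
Proof.
move=> q0; pose A := (blockc q)^-1 `^ q^-1.
case: r => [r| |//]; last first.
  move=> _; exists A => u uq; rewrite (lorentz_norm_fin q0 uq) lorentz_normyE; last first.
    exact: lorentz_bdd uq.
  apply: ge_ereal_sup => _ [j _ <-]; rewrite -EFinM lee_fin.
  exact: profile_le_lnorm.
rewrite lte_fin => qr; exists (A `^ (1 - q / r)) => u uq.
have /(lorentz_norm_interp q0 qr uq) := fun j => profile_le_lnorm j q0 uq.
rewrite (lorentz_norm_fin q0 uq) -EFinM => /le_trans; apply; rewrite lee_fin -/A.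
rewrite powRM ?powR_ge0// -mulrA -powRD; last by rewrite subrK oner_eq0.
by rewrite subrK powRr1 ?powR_ge0.
Qed.
End Profile.

(** * Flat vectors in infinite-dimensional subspaces *)

Section Subspace.
Variable R : realType.
Implicit Types (Z : set (nat -> R)) (u x y z : nat -> R).

Lemma combE (a : R) (x y : nat -> R) i : (a *: x + y) i = a * x i + y i.
Proof. by []. Qed.

Lemma scaleE (a : R) (x : nat -> R) i : (a *: x) i = a * x i.
Proof. by []. Qed.

Lemma submodP Z : submod_closed [in Z] ->
  Z 0 /\ forall a x y, Z x -> Z y -> Z (a *: x + y).
Proof.
move=> [Z0 ZD]; split; first by move: Z0; rewrite inE.
by move=> a x y Zx Zy; have := ZD a x y; rewrite !inE; apply.
Qed.

(** If restriction to the first [M] coordinates is injective on [Z] then [Z] is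
    finite-dimensional.  Induction on [M]: the vectors of [Z] vanishing at the
    last coordinate form a subspace to which the induction hypothesis applies,
    and at most one further vector is needed to span [Z]. *)
Lemma finite_dimensional_restr M Z : submod_closed [in Z] ->
  (forall z, Z z -> (forall i, (i < M)%N -> z i = 0) -> z = 0) ->
  finite_dimensional Z.
Proof.
elim: M Z => [|M IH] Z /[dup] sZ /submodP[Z0 ZD] H.
  exists 0%N, (fun=> 0); split=> [[]//|z Zz].
  by exists (fun=> 0); rewrite big_ord0; exact: H.
pose Z' := Z `&` [set z | z M = 0].
have sZ' : submod_closed [in Z'].
  split; first by rewrite inE.
  move=> a x y; rewrite !inE => -[Zx xM] [Zy yM]; split; first exact: ZD.
  by rewrite /= combE xM yM mulr0 addr0.
have [n [e [Ze eP]]] : finite_dimensional Z'.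
  apply: IH => // z [Zz zM] zi; apply: H => // i; rewrite ltnS leq_eqVlt.
  by case/predU1P => [->//|/zi].
have [[w [Zw wM]]|nw] := pselect (exists w, Z w /\ w M != 0); last first.
  exists n, e; split=> [i|z Zz]; first by case: (Ze i).
  apply: eP; split=> //=; apply/eqP/negPn/negP => zM.
  by apply: nw; exists z.
exists n.+1, (fun i => if unlift ord0 i is Some j then e j else w).
split=> [i|z Zz]; first by case: unliftP => // j _; case: (Ze j).
have [c cE] : exists c : 'I_n -> R, (- (z M / w M)) *: w + z = \sum_(i < n) c i *: e i.
  apply: eP; split; first exact: ZD.
  by rewrite /= combE mulNr divfK// addNr.
exists (fun i => if unlift ord0 i is Some j then c j else z M / w M).
rewrite big_ord_recl unlift_none; under eq_bigr do rewrite liftK.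
by rewrite -cE addrA -scalerDl subrr scale0r add0r.
Qed.

Lemma vanishing_vector M Z : submod_closed [in Z] -> ~ finite_dimensional Z ->
  exists z, [/\ Z z, z <> 0 & forall i, (i < M)%N -> z i = 0].
Proof.
move=> sZ nf; apply: contrapT => H; apply: nf.
apply: (finite_dimensional_restr (M := M)) => // z Zz zM.
by apply: contrapT => z0; apply: H; exists z.
Qed.

(** The sup norm is scaled to 3/2 rather than 1, so that an entry of modulus at
    least 1 exists without the supremum having to be attained. *)
Lemma normalized_vanishing_vector M Z : submod_closed [in Z] ->
  ~ finite_dimensional Z -> (forall z, Z z -> bdd z) ->
  exists z k, [/\ Z z, forall i, (i < M)%N -> z i = 0,
    forall i, `|z i| <= 3 / 2 & 1 <= `|z k|].
Proof.
move=> sZ nf bZ; have [z [Zz z0 zM]] := vanishing_vector M sZ nf.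
have bz := bZ z Zz.
have [j zj] : exists j, z j != 0.
  apply: contrapT => H; apply: z0; apply/funext => j; apply/eqP/negPn/negP => h.
  by apply: H; exists j.
have s0 : 0 < star z 0.
  by apply: lt_le_trans (normr_le_star0 j bz); rewrite normr_gt0.
have [k zk] : exists k, 2 / 3 * star z 0 <= `|z k|.
  apply: contrapT => H; suff : star z 0 <= 2 / 3 * star z 0 by lra.
  apply: star0_le => [|i]; first by lra.
  by rewrite leNgt; apply/negP => /ltW h; apply: H; exists i.
pose a := 3 / 2 / star z 0.
have a0 : 0 < a by rewrite divr_gt0//; lra.
have aE i : `|(a *: z) i| = a * `|z i|.
  by rewrite scaleE normrM gtr0_norm.
have [_ ZD] := submodP sZ; have [Z0 _] := submodP sZ.
exists (a *: z), k; split.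
- by rewrite -[_ *: _]addr0; exact: ZD.
- by move=> i /zM zi; rewrite scaleE zi mulr0.
- move=> i; rewrite aE /a mulrAC ler_pdivrMr// ler_pM2l; last lra.
  exact: normr_le_star0.
- rewrite aE /a mulrAC ler_pdivlMr//; lra.
Qed.

(** The first gliding hump.  The next vector [z] starts where [x] has become at
    most 1/2, which leaves the entries of [x] selected so far unchanged, keeps
    the sup norm at most [1/2 + 3/2], and gives an entry of modulus at least
    [1 - 1/2].  The errors do not accumulate, as it is the tail of the whole
    sum [x] that is made small. *)
Lemma flat_vector n Z : submod_closed [in Z] ->
  ~ finite_dimensional Z -> (forall z, Z z -> bdd z) ->
  (forall z e, Z z -> 0 < e -> exists M, forall i, (M <= i)%N -> `|z i| <= e) ->
  exists x s, [/\ Z x, forall i, `|x i| <= 2, uniq s, size s = n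
    & forall i, i \in s -> 2^-1 <= `|x i|].
Proof.
move=> sZ nf bZ cZ; have [Z0 ZD] := submodP sZ.
elim: n => [|n [x [s [Zx x2 us sn sx]]]].
  by exists 0, [::]; split => // i; rewrite normr0.
have [M xM] := cZ x 2^-1 Zx ltac:(by rewrite invr_gt0).
pose M' := maxn M (\max_(i <- s) i).+1.
have [z [k [Zz zM z32 zk]]] := normalized_vanishing_vector M' sZ nf bZ.
have kM : (M' <= k)%N.
  by rewrite leqNgt; apply/negP => /zM E; move: zk; rewrite E normr0 ler10.
have sM i : i \in s -> (i < M')%N.
  move=> si; apply: leq_trans (leq_maxr _ _); rewrite ltnS.
  exact: leq_bigmax_seq.
have MM : (M <= M')%N by exact: leq_maxl.
have zxE i : (1 *: x + z) i = x i + z i by rewrite scale1r.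
exists (1 *: x + z), (k :: s); split.
- exact: ZD.
- move=> i; rewrite zxE; have [iM|Mi] := ltnP i M'.
    by rewrite zM// addr0.
  apply: le_trans (ler_normD _ _) _.
  have := xM i (leq_trans MM Mi); have := z32 i; lra.
- by rewrite /= us andbT; apply/negP => /sM; rewrite ltnNge kM.
- by rewrite /= sn.
- move=> i; rewrite inE zxE => /predU1P[->|si]; last by rewrite zM ?addr0 ?sx ?sM.
  have := xM k (leq_trans MM kM); have := ler_normB (x k + z k) (x k).
  rewrite addrC addKr; lra.
Qed.

End Subspace.

(** * Superposing vectors of separated scales *)

Section Humps.
Variables (R : realType) (p q : R).
Hypotheses (p_gt0 : 0 < p) (q_gt0 : 0 < q).
Implicit Types (u v x y z : nat -> R) (N M j : nat).

(** [N] indices below [M] at which [f] is at least [c], separated by factors of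
    about 2: all the humps preceding the one at [b] lie below some
    [a <= (b + 1) / 2], so that the blocks of [block_ge] attached to them are
    disjoint. *)
Fixpoint humps (f : nat -> R) (c : R) N M : Prop :=
  if N is N'.+1 then
    exists a b, [/\ (b < M)%N, (a.*2 <= b.+1)%N, c <= f b & humps f c N' a]
  else True.

Lemma humps_transfer (f g : nat -> R) c d N M : d <= c ->
  (forall j, (j < M)%N -> f j - (c - d) <= g j) ->
  humps f c N M -> humps g d N M.
Proof.
move=> dc; elim: N M => [//|N IH] M fg /= [a [b [bM ab cf fa]]].
exists a, b; split=> //; first by have := fg b bM; lra.
apply: IH fa => j ja; apply: fg; lia.
Qed.

Lemma humps_widen (f : nat -> R) c N M M' : (M <= M')%N ->
  humps f c N M -> humps f c N M'.
Proof.
case: N => // N MM /= [a [b [bM ab cf fa]]].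
by exists a, b; split=> //; exact: leq_trans MM.
Qed.

Lemma humps_sum u c N M : bdd u -> 0 <= c -> humps (profile p u) c N M ->
  N%:R * (blockc p q * c `^ q) <= \sum_(0 <= j < M) lterm p q u j.
Proof.
move=> bu c0; elim: N M => [|N IH] M /=.
  by rewrite mul0r sumr_ge0// => j _; exact: lterm_ge0.
move=> [a [b [bM ab cb /IH ua]]].
have aM : (a <= M)%N by lia.
rewrite (big_cat_nat (leq0n a) aM)/= -natr1 mulrDl mul1r lerD//.
have ab1 : (a <= b.+1)%N by lia.
rewrite (big_cat_nat ab1 bM)/=; apply: ler_wpDr.
  by rewrite sumr_ge0// => j _; exact: lterm_ge0.
apply: le_trans (block_ge p_gt0 q_gt0 bu ab).
rewrite ler_wpM2l ?(ltW (blockc_gt0 _ _))//.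
by apply: ge0_ler_powR; rewrite ?nnegrE ?(ltW q_gt0) ?profile_ge0.
Qed.

Let kappa : R := 2 `^ p^-1.

Lemma kappa_ge1 : 1 <= kappa.
Proof. by rewrite -[leLHS](powRr0 2) ler_powR ?invr_ge0 ?(ltW p_gt0)// ler1n. Qed.

(** Halving the index splits it evenly between [u] and [v], at the cost of a
    factor [2^(1/p)] in the weight. *)
Lemma profileD_half u v k : bdd u -> bdd v ->
  profile p (u + v) k <= kappa * (profile p u k./2 + profile p v k./2).
Proof.
move=> bu bv; rewrite -mulrDr mulrA -powRM//.
apply: ler_pM; rewrite ?powR_ge0 ?star_ge0//.
  apply: ge0_ler_powR; rewrite ?nnegrE ?invr_ge0 ?(ltW p_gt0) ?mulr_ge0//.
  by rewrite -natrM ler_nat; lia.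
apply: le_trans (starD _ _ bu bv).
by apply: star_noninc; [exact: bddD|lia].
Qed.

(** Here the whole index goes to [u]: a perturbation of small sup norm changes
    the profile little on any fixed initial segment. *)
Lemma profileD_star0 u v j W d : bdd u -> bdd v -> star v 0 <= d ->
  j.+1%:R <= W -> profile p (u + v) j <= profile p u j + W `^ p^-1 * d.
Proof.
move=> bu bv vd jW; have W0 : 0 <= W by apply: le_trans jW.
apply: (@le_trans _ _ (profile p u j + j.+1%:R `^ p^-1 * star v 0)).
  rewrite -mulrDr ler_wpM2l ?powR_ge0//.
  by have := starD j 0 bu bv; rewrite addn0.
rewrite lerD2l; apply: ler_pM; rewrite ?powR_ge0 ?star_ge0//.
by apply: ge0_ler_powR; rewrite ?nnegrE ?invr_ge0 ?(ltW p_gt0).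
Qed.

Variable Z : set (nat -> R).
Hypotheses (sZ : submod_closed [in Z]) (nfZ : ~ finite_dimensional Z).
Hypothesis Zpq : Z `<=` lorentz p q%:E.

Let bZ z : Z z -> bdd z.
Proof. by move/Zpq; exact: lorentz_bdd. Qed.

Lemma subspace_c0 z e : Z z -> 0 < e ->
  exists M, forall i, (M <= i)%N -> `|z i| <= e.
Proof.
move=> Zz e0; have e20 : 0 < e / 2 by rewrite divr_gt0.
have [M zM] := profile_cvg0 p_gt0 q_gt0 (Zpq Zz) e20.
apply: (@star_small _ z M); first exact: bZ.
have := zM M (leqnn M); rewrite /profile => h.
suff : star z M <= M.+1%:R `^ p^-1 * star z M by lra.
rewrite ler_peMl ?star_ge0// -[leLHS](powRr0 M.+1%:R) ler_powR ?invr_ge0 ?(ltW p_gt0)//.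
by rewrite ler1n.
Qed.

(** A flat vector with [n] large entries has profile at least [n^(1/p) / 2] at
    its [n]-th index; dividing by the supremum of its profile leaves a sup norm
    of order [n^(-1/p)]. *)
Lemma spread_vector d : 0 < d -> exists x j,
  [/\ Z x, forall i, profile p x i <= 1, 2^-1 <= profile p x j & star x 0 <= d].
Proof.
move=> d0; have [Z0 ZD] := submodP sZ.
have t0 : 0 <= (4 / d) `^ p by exact: powR_ge0.
pose n := Num.truncn ((4 / d) `^ p).
have nd : 4 / d <= n.+1%:R `^ p^-1.
  apply: powR_le_root; rewrite ?divr_ge0 ?(ltW d0)//.
  by apply/ltW/truncnS_gt.
have [x [s [Zx x2 us sn sx]]] := flat_vector n.+1 sZ nfZ bZ subspace_c0.
have bx := bZ Zx.
have xn : 2 / d <= profile p x n.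
  have : 2^-1 <= star x n by apply: (le_star bx us); rewrite ?sn.
  move=> h; apply: (@le_trans _ _ (4 / d * 2^-1)).
    by rewrite mulrAC; apply: ler_wpM2r; [rewrite invr_ge0 ltW|lra].
  by apply: ler_pM => //; rewrite divr_ge0 ?(ltW d0).
pose B := sup (range (profile p x)).
have hB : has_sup (range (profile p x)).
  split; first by exists (profile p x 0), 0%N.
  exists ((blockc p q)^-1 `^ q^-1 * lnorm p q x) => _ [j _ <-].
  by apply: profile_le_lnorm => //; exact: Zpq.
have pB j : profile p x j <= B by apply: sup_upper_bound => //; exists j.
have d20 : 0 < 2 / d by rewrite divr_gt0.
have B0 : 0 < B by apply: lt_le_trans (pB n); exact: lt_le_trans xn.
have B20 : 0 < B / 2 by rewrite divr_gt0.
have [_ [j _ <-] jB] := sup_adherent B20 hB.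
have BV : 0 < B^-1 by rewrite invr_gt0.
exists (B^-1 *: x), j; split.
- by rewrite -[_ *: _]addr0; exact: ZD.
- by move=> i; rewrite profileZ// gtr0_norm// ler_pdivrMl// mulr1.
- rewrite profileZ// gtr0_norm// ler_pdivlMl//; rewrite -/B in jB; lra.
- rewrite starZ// gtr0_norm// ler_pdivrMl//.
  apply: le_trans (star0_le _ x2) _ => //.
  by rewrite -ler_pdivrMr//; exact: le_trans (pB n).
Qed.

(** The second gliding hump.  The bounds on the profile and on the humps worsen
    at each step, hence the strict inequalities for [K] and [c]: the sup norm
    of the next vector is chosen after them, small enough for the perturbation
    to use only half of the remaining room. *)
Lemma many_humps N : exists y K c M,
  [/\ Z y, K < 2 * kappa, (8 * kappa)^-1 < c,
      forall j, profile p y j <= K & humps (profile p y) c N M].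
Proof.
have [Z0 ZD] := submodP sZ; have k1 := kappa_ge1.
have k0 : 0 < kappa by lra.
have k8 : 0 < (8 * kappa)^-1 by rewrite invr_gt0; lra.
have k4E : (4 * kappa)^-1 = 2 * (8 * kappa)^-1.
  by field; rewrite gt_eqF.
have k4 : kappa * (4 * kappa)^-1 = 4^-1 by field; rewrite gt_eqF.
have kV : (8 * kappa)^-1 <= 8^-1 by rewrite lef_pV2 ?posrE; lra.
elim: N => [|N [y [K [c [M [Zy K2 c8 yK yh]]]]]].
  exists 0, 0, 1, 0%N; split => //; try lra.
  by move=> j; rewrite -(scale0r (0 : nat -> R)) profileZ ?normr0 ?mul0r//; exact: bZ.
have bdy := bZ Zy.
have k40 : 0 < (4 * kappa)^-1 by lra.
have [M1 yM1] := profile_cvg0 p_gt0 q_gt0 (Zpq Zy) k40.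
have [L [ML M1L]] : exists L, (M <= L)%N /\ (M1 <= L)%N.
  by exists (maxn M M1); rewrite leq_maxl leq_maxr.
(* e is the change of profile allowed on the indices up to 4 * L + 3. *)
have [e [e0 eK ec e1]] : exists e, [/\ 0 < e, e <= (2 * kappa - K) / 2,
    e <= (c - (8 * kappa)^-1) / 2 & e <= 4^-1].
  exists (Num.min 4^-1 (Num.min ((2 * kappa - K) / 2) ((c - (8 * kappa)^-1) / 2))).
  rewrite !ge_min !lexx !orbT !lt_min; split=> //.
  by apply/and3P; split; lra.
pose W : R := (4 * L.+1)%:R.
have W0 : 0 < W `^ p^-1 by rewrite powR_gt0 ?ltr0n.
have [x [j0 [Zx x1 xj xd]]] := spread_vector (divr_gt0 e0 W0).
have bx := bZ Zx.
have WdE : W `^ p^-1 * (e / W `^ p^-1) = e by rewrite mulrC divfK ?gt_eqF.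
have bNx : bdd (- x) by rewrite -scaleN1r; exact: bddZ.
have bNy : bdd (- y) by rewrite -scaleN1r; exact: bddZ.
have Nxd : star (- x) 0 <= e / W `^ p^-1.
  by rewrite -scaleN1r starZ// normrN1 mul1r.
have bz := bddD bdy bx.
have up j : j.+1%:R <= W -> profile p (y + x) j <= profile p y j + e.
  by move=> /(profileD_star0 bdy bx xd); rewrite WdE.
have lo j : j.+1%:R <= W -> profile p y j - e <= profile p (y + x) j.
  by move=> /(profileD_star0 bz bNx Nxd); rewrite WdE addrK lerBlDr.
(* Up to W the profile of x is at most e, hence below 1/2: its hump lies
   further. *)
have far : W < j0.+1%:R.
  rewrite ltNge; apply/negP => j0W.
  have := profileD_star0 (bZ Z0) bx xd j0W; rewrite WdE add0r.
  have -> : profile p 0 j0 = 0.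
    by rewrite -(scale0r (0 : nat -> R)) profileZ ?normr0 ?mul0r//; exact: bZ.
  lra.
move: far; rewrite /W ltr_nat => far.
have [b [bE bL]] : exists b, j0./2 = b /\ (L.*2 < b)%N.
  by exists j0./2; split=> //; clear -far; lia.
(* x = (y + x) - y, and the profile of y is negligible at b: the hump of x at
   j0 gives one of y + x at b = j0 / 2. *)
have zb : (4 * kappa)^-1 <= profile p (y + x) b.
  have := profileD_half j0 bz bNy; rewrite addrAC subrr add0r bE.
  rewrite -(scaleN1r y) profileZ// normrN1 mul1r => h.
  have /(ler_wpM2l (ltW k0)) := yM1 b ltac:(clear -bL M1L; lia); rewrite k4 => h'.
  rewrite mulrDr in h.
  rewrite -(ler_pM2l k0) k4; lra.
pose c' := Num.min (c - e) (4 * kappa)^-1.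
have [cce ck] : c' <= c - e /\ c' <= (4 * kappa)^-1.
  by rewrite !ge_min !lexx orbT.
have c'8 : (8 * kappa)^-1 < c' by rewrite lt_min; apply/andP; split; lra.
exists (y + x), (Num.max (K + e) (5 / 4 * kappa)), c', b.+1; split=> //.
- by rewrite -[y]scale1r; exact: ZD.
- by rewrite gt_max; apply/andP; split; lra.
- move=> j; rewrite le_max; have [jL|Lj] := ltnP j L.*2.
    have /up h : j.+1%:R <= W by rewrite ler_nat; clear -jL; lia.
    by rewrite (le_trans h)// lerD2r.
  apply/orP; right; apply: le_trans (profileD_half j bdy bx) _.
  have /(ler_wpM2l (ltW k0)) := yM1 j./2 ltac:(clear -Lj M1L; lia); rewrite k4 => h'.
  have /(ler_wpM2l (ltW k0)) := x1 j./2; rewrite mulr1 => h''.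
  rewrite mulrDr; lra.
- exists L, b; split=> //; [clear -bL; lia|exact: le_trans ck zb|].
  apply: (humps_widen ML); apply: humps_transfer yh; first lra.
  move=> j jM; have /lo h : j.+1%:R <= W by rewrite ler_nat; clear -jM ML; lia.
  lra.
Qed.

(** The vectors of [many_humps] have profiles bounded by [2 * kappa] and
    [q]-sums at least proportional to [N]. *)
Lemma subspace_contrast d : 0 < d ->
  exists x, [/\ Z x, lnorm p q x = 1 & forall j, profile p x j <= d].
Proof.
move=> d0; have k1 := kappa_ge1; have [Z0 ZD] := submodP sZ.
have k80 : 0 < (8 * kappa)^-1 by rewrite invr_gt0; lra.
pose c1 := blockc p q * (8 * kappa)^-1 `^ q.
have c10 : 0 < c1 by rewrite mulr_gt0 ?blockc_gt0 ?powR_gt0.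
pose T := (2 * kappa / d) `^ q.
have [y [K [c [M [Zy K2 c8 yK yh]]]]] := many_humps (Num.truncn (T / c1)).+1.
have bdy := bZ Zy.
have h : T <= fine (lsum p q y).
  rewrite -lee_fin fineK; last exact: lorentz_lsum (Zpq Zy).
  apply: le_trans (sum_le_lsum p q y 0 M); rewrite lee_fin.
  have c0 : 0 <= c by lra.
  apply: le_trans (humps_sum bdy c0 yh).
  apply: (@le_trans _ _ ((Num.truncn (T / c1)).+1%:R * c1)).
    by rewrite -ler_pdivrMr//; apply/ltW/truncnS_gt.
  rewrite ler_wpM2l// ler_wpM2l ?(ltW (blockc_gt0 _ _))//.
  by apply: ge0_ler_powR; rewrite ?nnegrE ?(ltW q_gt0) ?(ltW k80) ?(ltW c8).
have ny : 2 * kappa / d <= lnorm p q y.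
  by apply: powR_le_root => //; rewrite ?divr_ge0 ?(ltW d0) ?fine_ge0 ?lsum_ge0//; lra.
have n0 : 0 < lnorm p q y.
  by apply: lt_le_trans ny; rewrite divr_gt0//; lra.
have V0 : 0 < (lnorm p q y)^-1 by rewrite invr_gt0.
exists ((lnorm p q y)^-1 *: y); split.
- by rewrite -[_ *: _]addr0; exact: ZD.
- by rewrite (lnormZ _ q_gt0 (Zpq Zy)) gtr0_norm// mulVf ?gt_eqF.
- move=> j; rewrite profileZ// gtr0_norm// ler_pdivrMl//.
  by move: ny; rewrite ler_pdivrMr// => ny; have := yK j; lra.
Qed.

End Humps.

Unset Implicit Arguments.
Theorem theorem3p3 (R : realType) (p : R) (q r : \bar R)
  (p_gt0 : 0 < p) (q_gt0 : (0 < q)%E) (lt_qr : (q < r)%E) :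
  strictly_singular
    (lorentz p q) (lorentz_norm p q)
    (lorentz p r) (lorentz_norm p r)
    (fun u : nat -> R => u).
Proof.
case: q q_gt0 lt_qr => [q| |//]; last by move=> _; rewrite ltNge leey.
rewrite lte_fin => q_gt0 qr; split.
  have [C HC] := lorentz_norm_le p_gt0 q_gt0 qr.
  split=> //; last by exists C.
  move=> u uq; apply: le_lt_trans (HC u uq) _.
  by rewrite (lorentz_norm_fin q_gt0 uq) -EFinM ltry.
move=> Z Zpq sZ nf; apply/eqP; rewrite eq_le; apply/andP; split.
  apply/lee_addgt0Pr => e e0; rewrite add0e.
  have [d d0 small] := lorentz_norm_small p q_gt0 qr e0.
  have [x [Zx x1 xd]] := subspace_contrast p_gt0 q_gt0 sZ nf Zpq d0.
  apply: ge_ereal_inf; exists (lorentz_norm p r x); last exact: small (Zpq _ Zx) _ _.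
  exists x => //; split=> //=.
  by rewrite -[LHS]/(lorentz_norm p q%:E x) (lorentz_norm_fin q_gt0 (Zpq _ Zx)) x1.
apply: le_ereal_inf_tmp => _ [x [/Zpq xq _] <-].
case: r qr => [r| |//] _; first exact: poweR_ge0.
rewrite lorentz_normyE; last exact: lorentz_bdd q_gt0 xq.
apply: le_ereal_sup_tmp; exists (profile p x 0)%:E; first by exists 0%N.
by rewrite lee_fin profile_ge0.
Qed.
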